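(* Let $N\ge 2$ and $n>1$ be integers. If $N>2$, then every $2n$-valent type I regular balanced ($1$-balanced) Cayley map on an abelian group of exponent $N$ is isomorphic to $\mathcal{M}_Q$ for a unique ideal $Q\in\mathcal{I}(N,n)$. If $N=2$, then every $n$-valent type II regular balanced ($1$-balanced) Cayley map on an abelian group of exponent $2$ is isomorphic to $\mathcal{M}_Q$ for a unique ideal $Q\in\mathcal{I}(2,n)$.
   Context: Cayley maps. Let $\Gamma$ be a finite group and $\Omega$ a generating set not containing the identity and closed under inverses. The Cayley graph has vertex set $\Gamma$ and arc set $\Gamma\times\Omega$, where $(\eta,\omega)$ is the arc from $\eta$ to $\eta\omega$. Given a cyclic permutation $\rho$ of $\Omega$ (a single cycle of length $|\Omega|$), the Cayley map $\mathcal{CM}(\Gamma,\Omega,\rho)$ is the Cayley graph together with the rotation $(\eta,\omega)\mapsto(\eta,\rho(\omega))$ on arcs (equivalently, the induced embedding in a closed oriented surface). It is $|\Omega|$-valent. An isomorphism $\mathcal{CM}(\Gamma,\Omega,\rho)\to\mathcal{CM}(\Gamma',\Omega',\rho')$ is an isomorphism of the underlying graphs whose induced bijection on arcs $\alpha:\Gamma\times\Omega\to\Gamma'\times\Omega'$ satisfies $\alpha\circ\rho=\rho'\circ\alpha$, where $\rho,\rho'$ denote the rotations on arcs. A Cayley map is regular if for any two arcs there is a unique automorphism sending one to the other. If $\Omega=\{\omega_1,\ldots,\omega_m\}$ and $\rho(\omega_i)=\omega_{i+1}$ (subscripts mod $m$), write $\mathcal{CM}(\Gamma,\Omega)$ or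 $\mathcal{CM}(\Gamma,\{\omega_1,\dots,\omega_m\})$. For an integer $t>0$, a regular Cayley map is $t$-balanced if $\rho(\omega)^{-1}=\rho^{t}(\omega^{-1})$ for all $\omega\in\Omega$; it is balanced if $t=1$. Types. Let $m=|\Omega|$, choose $\omega\in\Omega$ and write $\omega^{-1}=\rho^{\ell}(\omega)$. Let $(t-1,m)$ be the greatest common divisor, with the convention $(t-1,m)=m$ if $t=1$. The map is of type I if $(t-1,m)\nmid\ell$ and of type II if $(t-1,m)\mid\ell$ (this does not depend on the choice of $\omega$). Rings. $\mathbb{Z}_N=\mathbb{Z}/N\mathbb{Z}$. For an ideal $Q\le\mathbb{Z}_N[x]$, $F_N(Q)=\mathbb{Z}_N[x]/Q$ (also regarded as an additive abelian group), and $\overline{\alpha}$ is the image of $\alpha\in\mathbb{Z}_N[x]$ in $F_N(Q)$. $\mathcal{I}(N,n)$ is the set of ideals $Q\le\mathbb{Z}_N[x]$ such that $x^n+1\in Q$ and $x^u+1\notin Q$ whenever $0<u<n$. For $Q\in\mathcal{I}(N,n)$, put $\Omega_Q=\{1,\overline{x},\ldots,\overline{x}^{2n-1}\}$ if $N>2$ and $\Omega_Q=\{1,\overline{x},\ldots,\overline{x}^{n-1}\}$ if $N=2$, in this cyclic order, and let $\mathcal{M}_Q=\mathcal{CM}(F_N(Q),\Omega_Q)$. *)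

(* Defs.v *)
From HB Require Import structures.
From mathcomp Require Import all_boot all_order all_algebra.
From mathcomp Require Import all_fingroup all_solvable.

Set Implicit Arguments.
Unset Strict Implicit.
Unset Printing Implicit Defensive.

Import GRing.Theory.

Section CayleyMap.

Local Open Scope group_scope.

(* The cyclic permutation of the generating set is extended by the identity
   to a permutation of the whole group ([perm_on]), which makes the
   representation unique. *)
Record cayley_map (gT : finGroupType) := CayleyMap {
  cm_gens : {set gT};
  cm_rho : {perm gT};
  cm_gens_generate : <<cm_gens>> = [set: gT];
  cm_gens_neq1 : 1 \notin cm_gens;
  cm_gensV : forall w, w \in cm_gens -> w^-1 \in cm_gens;
  cm_rho_on : perm_on cm_gens cm_rho;
  cm_rho_cycle : forall w, w \in cm_gens -> porbit cm_rho w = cm_gens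
}.

Definition valency (gT : finGroupType) (M : cayley_map gT) : nat :=
  #|cm_gens M|.

Definition cm_adj (gT : finGroupType) (M : cayley_map gT) : rel gT :=
  fun x y => [exists w in cm_gens M, y == x * w].

Definition cm_arcs (gT : finGroupType) (M : cayley_map gT) : {set gT * gT} :=
  setX [set: gT] (cm_gens M).

Definition arc_rho (gT : finGroupType) (M : cayley_map gT) (a : gT * gT) :
  gT * gT := (a.1, cm_rho M a.2).

(* The arc (x, w) runs from x to x * w, so its image runs from f x to
   f (x * w). *)
Definition arc_map (gT hT : finGroupType) (f : gT -> hT) (a : gT * gT) :
  hT * hT := (f a.1, (f a.1)^-1 * f (a.1 * a.2)).

Definition cm_isom (gT hT : finGroupType) (M : cayley_map gT)
    (M' : cayley_map hT) (f : gT -> hT) : Prop :=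
  [/\ bijective f,
      forall x y, cm_adj M' (f x) (f y) = cm_adj M x y
    & {in cm_arcs M, forall a, arc_map f (arc_rho M a) = arc_rho M' (arc_map f a)}].

Definition cm_isomorphic (gT hT : finGroupType) (M : cayley_map gT)
    (M' : cayley_map hT) : Prop :=
  exists f : gT -> hT, cm_isom M M' f.

Definition cm_regular (gT : finGroupType) (M : cayley_map gT) : Prop :=
  {in cm_arcs M &, forall a b,
    exists! f : {perm gT}, cm_isom M M f /\ arc_map f a = b}.

Definition regular_balanced (gT : finGroupType) (t : nat) (M : cayley_map gT) :
    Prop :=
  cm_regular M /\
  {in cm_gens M, forall w, (cm_rho M w)^-1 = (cm_rho M ^+ t) w^-1}.

(* [gcdn 0 m = m], which is the convention for t = 1. *)
Definition type_I (gT : finGroupType) (t : nat) (M : cayley_map gT) : Prop :=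
  exists w l, [/\ w \in cm_gens M, w^-1 = (cm_rho M ^+ l) w
    & ~~ (gcdn (t - 1) (valency M) %| l)].

Definition type_II (gT : finGroupType) (t : nat) (M : cayley_map gT) : Prop :=
  exists w l, [/\ w \in cm_gens M, w^-1 = (cm_rho M ^+ l) w
    & gcdn (t - 1) (valency M) %| l].

Section OfSeq.

Variables (gT : finGroupType) (s : seq gT).
Hypotheses (Us : uniq s) (gen_s : <<[set w in s]>> = [set: gT]).
Hypotheses (s1 : 1 \notin s) (sV : forall w, w \in s -> w^-1 \in s).

Definition seq_rho : {perm gT} := perm (can_inj (prev_next Us)).

Lemma seq_gens_neq1 : 1 \notin [set w in s].
Proof. by rewrite inE. Qed.

Lemma seq_gensV w : w \in [set w in s] -> w^-1 \in [set w in s].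
Proof. by rewrite !inE; exact: sV. Qed.

Lemma seq_rho_on : perm_on [set w in s] seq_rho.
Proof.
apply/subsetP=> w; rewrite !inE permE; apply: contraR => /negbTE wNs.
by rewrite next_nth wNs.
Qed.

Lemma seq_rho_cycle w :
  w \in [set w in s] -> porbit seq_rho w = [set w in s].
Proof.
rewrite inE => ws; apply/setP=> v.
have E : seq_rho =1 next s by move=> z; rewrite permE.
rewrite inE -(fconnect_cycle (cycle_next Us) ws) -(eq_fconnect E).
apply/porbitP/idP => [[i ->]|/iter_findex <-]; first by rewrite permX fconnect_iter.
by eexists; rewrite permX.
Qed.

(* CM(Gamma, {w_1, ..., w_m}) for s = [:: w_1; ...; w_m]. *)
Definition cm_of_seq : cayley_map gT :=
  CayleyMap gen_s seq_gens_neq1 seq_gensV seq_rho_on seq_rho_cycle.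

End OfSeq.

End CayleyMap.

Local Open Scope ring_scope.
Local Open Scope quotient_scope.

(* [idealr] is the type of proper ideals; for n > 1 the condition
   'X + 1 \notin Q already excludes the improper ideal. *)
Record ideal_I (N n : nat) := IdealI {
  ideal_val :> idealr {poly 'Z_N};
  ideal_Xn : 'X^n + 1 \in ideal_val;
  ideal_Xu : forall u : nat, (0 < u < n)%N -> 'X^u + 1 \notin ideal_val
}.

(* The hypothesis 1 < n ensures that the quotient ring is finite. *)
Definition F_quot (N n : nat) (hn : (1 < n)%N) (Q : ideal_I N n) : Type :=
  {ideal_quot (ideal_val Q)}.

Section Quotient.

Variables (N n : nat) (hn : (1 < n)%N) (Q : ideal_I N n).

Local Notation F := (F_quot hn Q).
Local Notation d := ('X^n + 1 : {poly 'Z_N}).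

HB.instance Definition _ := GRing.ComNzRing.on F.

Definition F_pi (p : {poly 'Z_N}) : F := \pi_({ideal_quot (ideal_val Q)}) p.

Lemma F_pi_eq p q : (F_pi p == F_pi q) = (p - q \in ideal_val Q).
Proof. by rewrite Quotient.idealrBE. Qed.

Fact F_pi_zmod : zmod_morphism F_pi.
Proof. by move=> p q; rewrite /F_pi rmorphB. Qed.
Fact F_pi_monoid : monoid_morphism F_pi.
Proof.
by split=> [|p q]; rewrite /F_pi ?rmorph1 ?rmorphM.
Qed.
HB.instance Definition _ := GRing.isZmodMorphism.Build _ _ F_pi F_pi_zmod.
HB.instance Definition _ := GRing.isMonoidMorphism.Build _ _ F_pi F_pi_monoid.

Definition F_coefs (a : F) : {ffun 'I_n -> 'Z_N} :=
  [ffun i : 'I_n =>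
     (Pdiv.Ring.rmodp (generic_quotient.repr (a : {ideal_quot (ideal_val Q)})) d)`_i].
Definition F_of_coefs (c : {ffun 'I_n -> 'Z_N}) : F :=
  F_pi (\poly_(i < n) (if insub i is Some j then c j else 0)).

Lemma F_coefsK : cancel F_coefs F_of_coefs.
Proof.
have n0 : (0 < n)%N := ltnW hn.
have sd : size d = n.+1.
  by rewrite size_polyDl ?size_polyXn // size_poly1.
have md : d \is monic.
  by rewrite monicE lead_coefDl ?lead_coefXn // size_polyXn size_poly1.
move=> a; rewrite /F_of_coefs.
set p := generic_quotient.repr (a : {ideal_quot (ideal_val Q)}).
have -> : \poly_(i < n) (if insub i is Some j then F_coefs a j else 0) =
          Pdiv.Ring.rmodp p d.
  apply/polyP=> i; rewrite coef_poly; case: ltnP => hi.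
    by rewrite insubT ffunE.
  rewrite nth_default // (leq_trans _ hi) // -ltnS -sd.
  by rewrite Pdiv.Ring.ltn_rmodpN0 ?monic_neq0.
have -> : a = F_pi p by rewrite /F_pi reprK.
apply/eqP; rewrite F_pi_eq.
rewrite [X in _ - X](Pdiv.RingMonic.rdivp_eq md) opprD addrC addrNK -mulNr.
by rewrite idealMr // ideal_Xn.
Qed.

HB.instance Definition _ := Countable.copy F (can_type F_coefsK).
HB.instance Definition _ : isFinite F := CanIsFinite F_coefsK.
HB.instance Definition _ := [finGroupMixin of F for +%R].


Definition x_bar : F := F_pi 'X.

Definition Omega_seq : seq F :=
  [seq x_bar ^+ i | i <- iota 0 (if (2 < N)%N then 2 * n else n)%N].

Lemma x_bar_n : x_bar ^+ n = -1.
Proof.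
apply/eqP; rewrite -rmorphXn -[-1](rmorphN1 F_pi) F_pi_eq opprK.
exact: ideal_Xn.
Qed.

Lemma oppr_N2 (a : F) : (N <= 2)%N -> - a = a.
Proof.
move=> N2; apply/eqP; rewrite eq_sym -addr_eq0 -mulr2n -mulr_natl.
suff -> : 2%:R = 0 :> F by rewrite mul0r.
rewrite -[2%:R](rmorph_nat F_pi) -[0](rmorph0 F_pi); congr F_pi.
rewrite -(rmorph_nat polyC) -[0](rmorph0 polyC); congr polyC.
have -> : 2%:R = (Zp_trunc N).+2%:R :> 'Z_N.
  by congr (_%:R); case: N N2 => [|[|[|]]].
by apply: val_inj; rewrite Zp_nat /=; exact: modnn.
Qed.

Lemma Omega_neq0 : (0 : F) \notin Omega_seq.
Proof.
apply/mapP=> -[i _ /esym x0].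
have : (x_bar ^+ i) ^+ n == (0 : F) by rewrite x0 expr0n; case: (n) hn.
rewrite -exprM mulnC exprM x_bar_n; case: (odd i) (signr_odd F i) => <-;
  by rewrite ?expr1 ?oppr_eq0 oner_eq0.
Qed.

Lemma OmegaN w : w \in Omega_seq -> - w \in Omega_seq.
Proof.
rewrite /Omega_seq; case: ltnP => N2; last by rewrite oppr_N2.
case/mapP=> i; rewrite mem_iota /= add0n => hi ->{w}.
have E : - x_bar ^+ i = x_bar ^+ (i + n) by rewrite exprD x_bar_n mulrN1.
have [lt_in|le_ni] := ltnP i n.
  by rewrite E; apply: map_f; rewrite mem_iota /= add0n mul2n -addnn ltn_add2r.
rewrite -[i in - _ ^+ i](subnK le_ni) exprD x_bar_n mulrN1 opprK.
by apply: map_f; rewrite mem_iota /= add0n (leq_ltn_trans (leq_subr _ _)).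
Qed.

Lemma Omega_gen : <<[set w in Omega_seq]>>%g = [set: F].
Proof.
apply/eqP; rewrite eqEsubset subsetT /=; apply/subsetP=> a _.
rewrite -(F_coefsK a) /F_of_coefs poly_def raddf_sum /=.
apply: group_prod => i _.
set c := if _ is Some _ then _ else _.
have -> : F_pi (c *: 'X^i) = (x_bar ^+ i) *+ c.
  rewrite -mul_polyC rmorphM rmorphXn /= -/x_bar -mulr_natl; congr (_ * _).
  by rewrite -[in LHS](natr_Zp c) !rmorph_nat.
have XE (z : F) k : (z ^+ k)%g = z *+ k.
  by elim: k => // k IHk; rewrite expgS mulrS IHk.
rewrite -XE; apply: groupX; apply: mem_gen; rewrite inE.
apply: map_f; rewrite mem_iota /= add0n; case: ifP => // _.
by rewrite mul2n -addnn (leq_trans (ltn_ord i)) ?leq_addr.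
Qed.

Let U := undup_uniq Omega_seq.
Let gen_U : <<[set w in undup Omega_seq]>>%g = [set: F].
Proof.
rewrite -Omega_gen; congr (<<_>>)%g; apply/setP=> w.
by rewrite !inE mem_undup.
Qed.
Let U1 : 1%g \notin undup Omega_seq.
Proof. by rewrite mem_undup Omega_neq0. Qed.
Let UV (w : F) : w \in undup Omega_seq -> w^-1%g \in undup Omega_seq.
Proof. by rewrite !mem_undup; exact: OmegaN. Qed.

(* The powers of x_bar in Omega_seq are pairwise distinct, so that [undup]
   has no effect, except when N > 2 and 2 \in Q; in that case the cyclic
   order on the set of these powers is still w |-> x_bar * w. *)
Definition M_Q : cayley_map F := cm_of_seq U gen_U U1 UV.

End Quotient.

(* Main.v *)
Require Import Defs.
From HB Require Import structures.
From mathcomp Require Import all_boot all_order all_algebra.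
From mathcomp Require Import all_fingroup all_solvable.

(** Let [f] be an automorphism of a balanced map fixing 1 and acting as the
    rotation on one generator.  For each vertex [x] the map
    [u |-> (f x)^-1 * f (x * u)] on generators commutes with the rotation; as
    inversion is a power of the rotation, this map is the same at adjacent
    vertices, so [f] is a group morphism extending the rotation.  On an abelian
    group of exponent [N] this makes the group a cyclic [Z_N[x]]-module, [x]
    acting as [f], generated by any generator [w] of the map; [Q] is the
    annihilator of [w].  The same argument applied to an isomorphism from [M] to
    [M_Q'] shows that, up to translation, it is [Z_N[x]]-linear and sends [w] to
    a unit of the quotient ring, whence [Q'] is that annihilator too. *)

Set Implicit Arguments.
Unset Strict Implicit.
Unset Printing Implicit Defensive.

Import GRing.Theory.

(** * The rotation on generators and isomorphisms of Cayley maps *)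

Section Isomorphisms.

Local Open Scope group_scope.

Lemma generated_ind (gT : finGroupType) (A : {set gT}) (P : gT -> Prop) :
  <<A>> = [set: gT] -> P 1 -> (forall x a, a \in A -> P x -> P (x * a)) ->
  forall x, P x.
Proof.
move=> genA P1 PM x; have: x \in <<A>> by rewrite genA inE.
case/gen_prodgP=> n [c Ac ->]; elim: n c Ac => [|n IHn] c Ac.
  by rewrite big_ord0.
by rewrite big_ord_recr /=; apply: PM => //; apply: IHn => i.
Qed.

Section Rotation.

Variables (gT : finGroupType) (M : cayley_map gT).
Implicit Types v w : gT.

Lemma rhoX_gens k w : ((cm_rho M ^+ k) w \in cm_gens M) = (w \in cm_gens M).
Proof.
elim: k => [|k IHk]; first by rewrite perm1.
by rewrite expgSr permM (perm_closed _ (cm_rho_on M)).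
Qed.

Lemma rho_gens w : (cm_rho M w \in cm_gens M) = (w \in cm_gens M).
Proof. exact: (rhoX_gens 1). Qed.

Lemma gens_rhoX w v : w \in cm_gens M -> v \in cm_gens M ->
  exists k, v = (cm_rho M ^+ k) w.
Proof. by move=> Aw; rewrite -{1}(cm_rho_cycle Aw) => /porbitP. Qed.

(** The rotation is one cycle on the generators, so [traject] from [w] lists [valency M] distinct
    elements and then returns to [w]. *)
Lemma eq_rhoX w a b : w \in cm_gens M ->
  ((cm_rho M ^+ a) w == (cm_rho M ^+ b) w) = (a == b %[mod valency M]).
Proof.
move=> Aw; have m_gt0 : 0 < valency M by apply/card_gt0P; exists w.
have E c : (cm_rho M ^+ c) w = nth w (traject (cm_rho M) w (valency M))
                                  (c %% valency M).
  rewrite nth_traject ?ltn_pmod // permX {1}(divn_eq c (valency M)) addnC iterD.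
  congr iter; elim: (c %/ _) => //= q IHq.
  by rewrite mulSn iterD IHq /valency -(cm_rho_cycle Aw) iter_porbit.
rewrite !E nth_uniq ?size_traject ?ltn_pmod //.
by rewrite /valency -(cm_rho_cycle Aw) uniq_traject_porbit.
Qed.

(** Balance says that inversion commutes with the rotation, which is transitive on generators, so
    the exponent found at [w] serves everywhere. *)
Lemma balanced_invg_rhoX w l :
    {in cm_gens M, forall v, (cm_rho M v)^-1 = (cm_rho M ^+ 1) v^-1} ->
    w \in cm_gens M -> w^-1 = (cm_rho M ^+ l) w ->
  {in cm_gens M, forall v, v^-1 = (cm_rho M ^+ l) v}.
Proof.
move=> bal Aw wV v /(gens_rhoX Aw)[k ->].
rewrite -permM -expgD addnC expgD permM -wV.
elim: k => [|k IHk]; first by rewrite !perm1.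
by rewrite expgSr !permM bal ?rhoX_gens // IHk.
Qed.

End Rotation.

(** * From map isomorphisms to group morphisms *)

Section Morphism.

Variables (gT hT : finGroupType) (M : cayley_map gT) (M' : cayley_map hT).
Variables (f : gT -> hT) (isof : cm_isom M M' f) (l : nat).
Hypothesis invM : {in cm_gens M, forall v, v^-1 = (cm_rho M ^+ l) v}.
Hypothesis invM' : {in cm_gens M', forall v, v^-1 = (cm_rho M' ^+ l) v}.

Lemma isom_arc_gens x v :
  v \in cm_gens M -> (f x)^-1 * f (x * v) \in cm_gens M'.
Proof.
move=> Av; case: isof => _ adj _; have: cm_adj M x (x * v).
  by apply/existsP; exists v; rewrite Av eqxx.
by rewrite -adj => /existsP[u /andP[Au /eqP->]]; rewrite mulKg.
Qed.

Lemma isom_arc_rhoX x v k : v \in cm_gens M ->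
  (f x)^-1 * f (x * (cm_rho M ^+ k) v) =
    (cm_rho M' ^+ k) ((f x)^-1 * f (x * v)).
Proof.
move=> Av; case: isof => _ _ E; elim: k => [|k IHk]; first by rewrite !perm1.
rewrite !expgSr !permM -IHk.
have /E : (x, (cm_rho M ^+ k) v) \in cm_arcs M by rewrite !inE rhoX_gens.
by case.
Qed.

(* The maps u |-> (f x)^-1 * f (x * u) commute with the rotations, so it is
   enough to compare them at the single generator v^-1. *)
Lemma isom_arc_adj x v u : v \in cm_gens M -> u \in cm_gens M ->
  (f (x * v))^-1 * f (x * v * u) = (f x)^-1 * f (x * u).
Proof.
move=> Av; have AvV : v^-1 \in cm_gens M by exact: cm_gensV.
case/(gens_rhoX AvV)=> k ->; rewrite !isom_arc_rhoX //.
congr ((_ : {perm _}) _).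
(* Both sides are the inverse of [(f x)^-1 * f (x * v)]: on the right, inversion is the same power
   [l] of both rotations. *)
rewrite mulgK (invM Av) isom_arc_rhoX // -invM' ?isom_arc_gens //.
by rewrite invMg invgK.
Qed.

Lemma isom_arc_const x u : u \in cm_gens M ->
  (f x)^-1 * f (x * u) = (f 1)^-1 * f u.
Proof.
move=> Au; move: x; apply: (generated_ind (cm_gens_generate M)) => [|x v Av <-].
  by rewrite mul1g.
exact: isom_arc_adj.
Qed.

(** Build [y] up from generators: by [isom_arc_const] each new factor multiplies the image by an
    amount independent of the vertex. *)
Lemma isom_translate_morph x y :
  (f 1)^-1 * f (x * y) = ((f 1)^-1 * f x) * ((f 1)^-1 * f y).
Proof.
move: y; apply: (generated_ind (cm_gens_generate M)) => [|y u Au IHy].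
  by rewrite mulg1 mulVg mulg1.
have E z : f (z * u) = f z * ((f 1)^-1 * f u).
  by rewrite -(isom_arc_const z Au) mulKVg.
by rewrite (mulgA x) !E [LHS]mulgA IHy -!mulgA.
Qed.

End Morphism.

(** Regularity gives an automorphism sending the arc [(1, w)] to [(1, cm_rho M w)]. It fixes 1, so
    it is its own translate. *)
Lemma regular_balanced_morphism (gT : finGroupType) (M : cayley_map gT) w l :
    regular_balanced 1 M -> w \in cm_gens M -> w^-1 = (cm_rho M ^+ l) w ->
  exists2 f : gT -> gT, {morph f : x y / x * y} &
    {in cm_gens M, f =1 cm_rho M}.
Proof.
case=> reg bal Aw wV; have inv := balanced_invg_rhoX bal Aw wV.
have arcM u : u \in cm_gens M -> (1, u) \in cm_arcs M by rewrite !inE.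
have Arw : cm_rho M w \in cm_gens M by rewrite rho_gens.
have [f [[isof [f1 fw]] _]] := reg _ _ (arcM _ Aw) (arcM _ Arw).
rewrite f1 invg1 !mul1g in fw; exists f => [x y | v /(gens_rhoX Aw)[k ->]].
  by have := isom_translate_morph isof inv inv x y; rewrite f1 invg1 !mul1g.
have := isom_arc_rhoX isof 1 k Aw; rewrite f1 invg1 !mul1g fw => ->.
by rewrite -!permM -expgS -expgSr.
Qed.

Lemma morphism_isom (gT hT : finGroupType) (M : cayley_map gT)
    (M' : cayley_map hT) (f : gT -> hT) :
    bijective f -> {morph f : x y / x * y} ->
    (forall v, (f v \in cm_gens M') = (v \in cm_gens M)) ->
    {in cm_gens M, forall v, f (cm_rho M v) = cm_rho M' (f v)} ->
  cm_isom M M' f.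
Proof.
move=> bijf fM f_gens f_rho.
have adjE (kT : finGroupType) (K : cayley_map kT) x y :
    cm_adj K x y = (x^-1 * y \in cm_gens K).
  apply/existsP/idP=> [[u /andP[Au /eqP->]] | A]; first by rewrite mulKg.
  by exists (x^-1 * y); rewrite A mulKVg eqxx.
have fV x y : (f x)^-1 * f y = f (x^-1 * y).
  by apply: (mulgI (f x)); rewrite mulKVg -fM mulKVg.
split=> // [x y | [x v]]; first by rewrite !adjE fV f_gens.
by rewrite !inE /arc_map /arc_rho /= !fV !mulKg => /f_rho->.
Qed.

End Isomorphisms.

Local Open Scope ring_scope.

(** * Polynomials acting on a vector through an endomorphism *)

Section CyclicModule.

Variables (R : comNzRingType) (V : lmodType R) (f : {linear V -> V}) (w : V).

Implicit Types p q : {poly R}.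

(** This is p(f) applied to [w]. *)
Definition poly_act (p : {poly R}) : V := \sum_(i < size p) p`_i *: iter i f w.

Lemma poly_act_widen m p :
  (size p <= m)%N -> poly_act p = \sum_(i < m) p`_i *: iter i f w.
Proof.
move=> le_pm; rewrite /poly_act.
rewrite (big_ord_widen m (fun i => p`_i *: iter i f w)) //.
rewrite big_mkcond; apply: eq_bigr => i _; case: ltnP => // le_pi.
by rewrite nth_default // scale0r.
Qed.

Fact poly_act_linear : linear poly_act.
Proof.
move=> c p q; set m := maxn (size p) (size q).
have [le_pm le_qm] : (size p <= m)%N /\ (size q <= m)%N.
  by rewrite leq_maxl leq_maxr.
have le_m : (size (c *: p + q)%R <= m)%N.
  rewrite (leq_trans (size_polyD _ _)) // geq_max le_qm andbT.
  exact: leq_trans (size_scale_leq _ _) le_pm.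
rewrite !(@poly_act_widen m) // scaler_sumr -big_split /=.
by apply: eq_bigr => i _; rewrite coefD coefZ scalerDl scalerA.
Qed.
HB.instance Definition _ := GRing.isLinear.Build R {poly R} V _ poly_act
  poly_act_linear.

Lemma poly_actXn k : poly_act 'X^k = iter k f w.
Proof.
rewrite /poly_act size_polyXn big_ord_recr /= big1 ?add0r => [|i _].
  by rewrite coefXn eqxx scale1r.
by rewrite coefXn ltn_eqF ?scale0r.
Qed.

Lemma poly_act1 : poly_act 1 = w.
Proof. by have := poly_actXn 0; rewrite expr0. Qed.

Lemma poly_actMX p : poly_act (p * 'X) = f (poly_act p).
Proof.
rewrite -[p]coefK poly_def mulr_suml !(linear_sum poly_act) linear_sum /=.
apply: eq_bigr => i _.
by rewrite -scalerAl -exprSr !linearZ /= !poly_actXn.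
Qed.

Lemma poly_actM_eq0 p q : poly_act p = 0 -> poly_act (q * p) = 0.
Proof.
move=> p0; elim/poly_ind: q => [|q c IHq]; first by rewrite mul0r linear0.
rewrite mulrDl mulrAC linearD /= poly_actMX IHq linear0 add0r.
by rewrite mul_polyC linearZ /= p0 scaler0.
Qed.

Definition poly_ann : {pred {poly R}} := [pred p | poly_act p == 0].

Hypothesis w_neq0 : w != 0.

(** Properness is where [w != 0] enters, since 1 acts on [w] as the identity. *)
Fact poly_ann_ideal : idealr_closed poly_ann.
Proof.
split=> [||a p q]; rewrite ?inE ?linear0 ?poly_act1 // => /eqP p0 /eqP q0.
by rewrite linearD /= q0 addr0 poly_actM_eq0.
Qed.

Definition ann_ideal : idealr {poly R} :=
  HB.pack poly_ann (isIdealr.Build {poly R} poly_ann poly_ann_ideal).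

Lemma mem_ann_ideal p : (p \in ann_ideal) = (poly_act p == 0).
Proof. by []. Qed.

End CyclicModule.

(** * Abelian groups of exponent dividing [N] as modules over ['Z_N] *)

Section ExponentModule.

Variables (N : nat) (N_gt1 : (1 < N)%N) (gT : finGroupType).
Hypotheses (cG : abelian [set: gT]) (eG : (exponent [set: gT] %| N)%N).

(* The hypotheses are arguments of this alias so that the additive structures
   below can be inferred from it. *)
Definition exp_mod of (1 < N)%N & abelian [set: gT]
  & (exponent [set: gT] %| N)%N : Type := gT.

Local Notation V := (exp_mod N_gt1 cG eG).

HB.instance Definition _ := Choice.copy V gT.

Fact exp_mod_mulC : commutative (@mulg gT).
Proof. by move=> x y; apply: (centsP cG); rewrite inE. Qed.

HB.instance Definition _ := GRing.isZmodule.Build V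
  (@mulgA gT) exp_mod_mulC (@mul1g gT) (@mulVg gT).

Definition exp_mod_scale (a : 'Z_N) (v : V) : V := ((v : gT) ^+ a)%g.

(** Arithmetic in ['Z_N] reduces modulo [(Zp_trunc N).+2], which is [N] as [N > 1]; powers do not
    see this reduction. *)
Lemma expg_modN (v : gT) k : (v ^+ (k %% (Zp_trunc N).+2) = v ^+ k)%g.
Proof.
by rewrite Zp_cast // expg_mod //; apply: (exponentP eG); rewrite inE.
Qed.

Fact exp_mod_scaleA a b v :
  exp_mod_scale a (exp_mod_scale b v) = exp_mod_scale (a * b) v.
Proof. by rewrite /exp_mod_scale /= expg_modN -expgM mulnC. Qed.

Fact exp_mod_scale1 : left_id 1 exp_mod_scale.
Proof. by move=> v; rewrite /exp_mod_scale /= expg1. Qed.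

Fact exp_mod_scaleDr : right_distributive exp_mod_scale +%R.
Proof. by move=> a u v; apply: expgMn; apply: exp_mod_mulC. Qed.

Fact exp_mod_scaleDl v : {morph exp_mod_scale^~ v : a b / a + b}.
Proof. by move=> a b; rewrite /exp_mod_scale /= expg_modN expgD. Qed.

HB.instance Definition _ := GRing.Zmodule_isLmodule.Build 'Z_N V
  exp_mod_scaleA exp_mod_scale1 exp_mod_scaleDr exp_mod_scaleDl.

Variables (f : gT -> gT) (fM : {morph f : x y / (x * y)%g}).

(** Scalars act as powers, which every group morphism respects. *)
Fact exp_mod_fun_linear : linear (f : V -> V).
Proof.
have f1 : f 1%g = 1%g by apply: (mulgI (f 1%g)); rewrite -fM !mulg1.
have fX k x : f (x ^+ k)%g = (f x ^+ k)%g.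
  by elim: k => [|k IHk]; rewrite ?expg0 // !expgS fM IHk.
by move=> a u v; rewrite [LHS]fM; congr (_ * _)%g; exact: fX.
Qed.

Definition exp_mod_lin : {linear V -> V} :=
  HB.pack (f : V -> V)
    (GRing.isLinear.Build 'Z_N V V _ (f : V -> V) exp_mod_fun_linear).

End ExponentModule.

(** * The rotation of the map [M_Q] *)

Section QuotientMap.

Variables (N n : nat) (hn : (1 < n)%N) (Q : ideal_I N n).

Local Notation F := (F_quot hn Q).
Local Notation x := (x_bar hn Q).
Local Notation Omega := (Omega_seq hn Q).
Local Notation m := (if (2 < N)%N then 2 * n else n)%N.

Lemma x_bar_2n : x ^+ (2 * n) = 1.
Proof. by rewrite mulnC exprM x_bar_n sqrrN expr1n. Qed.

Lemma x_bar_m : x ^+ m = 1.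
Proof. by case: ltnP => N2; rewrite ?x_bar_2n // x_bar_n oppr_N2. Qed.

Lemma iter_x_bar i : iter i ( *%R x) 1 = x ^+ i.
Proof. by elim: i => //= i ->; rewrite exprS. Qed.

Lemma OmegaP z : reflect (exists i, z = x ^+ i) (z \in Omega).
Proof.
apply: (iffP mapP) => [[i _ ->] | [i ->]]; first by exists i.
have m_gt0 : (0 < m)%N by case: ifP; rewrite ?muln_gt0 (ltnW hn).
exists (i %% m)%N; first by rewrite mem_iota add0n ltn_pmod.
by rewrite {1}(divn_eq i m) exprD mulnC exprM x_bar_m expr1n mul1r.
Qed.

Lemma Omega_traject : Omega = traject ( *%R x) 1 m.
Proof.
apply: (@eq_from_nth _ 1); rewrite size_map size_iota ?size_traject // => i lti.
by rewrite nth_traject // iter_x_bar (nth_map 0%N) ?size_iota // nth_iota.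
Qed.

Lemma Omega_fcycle : fcycle ( *%R x) Omega.
Proof.
rewrite Omega_traject; case E: m => [//|k].
rewrite /= -[X in rcons _ X]x_bar_m -iter_x_bar E iterSr -trajectSr.
exact: fpath_traject.
Qed.

Lemma mem_gens_M_Q z : (z \in cm_gens (M_Q hn Q)) = (z \in Omega).
Proof. by rewrite inE mem_undup. Qed.

(** [Omega] is a cycle of multiplication by [x], and removing repetitions from a functional cycle
    leaves one, so this holds even if powers coincide. *)
Lemma rho_M_Q z : z \in Omega -> cm_rho (M_Q hn Q) z = x * z.
Proof.
move=> Oz; rewrite permE; apply: nextE; last by rewrite mem_undup.
exact: (fcycle_undup Omega_fcycle).
Qed.

Lemma rhoX_M_Q z k : z \in Omega -> (cm_rho (M_Q hn Q) ^+ k)%g z = x ^+ k * z.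
Proof.
rewrite -mem_gens_M_Q => Oz; elim: k => [|k IHk]; first by rewrite perm1 mul1r.
by rewrite expgSr permM rho_M_Q -?mem_gens_M_Q ?rhoX_gens // IHk exprS mulrA.
Qed.

Lemma F_piC c (z : F) : F_pi hn Q c%:P * z = z *+ c.
Proof. by rewrite -mulr_natl -[in LHS](natr_Zp c) !rmorph_nat. Qed.

(** Since [x ^+ (2 * n) = 1], each power [z] of [x] has inverse [z ^+ (2 * n).-1]. *)
Lemma Omega_lreg z : z \in Omega -> GRing.lreg z.
Proof.
case/OmegaP=> i -> a b E.
rewrite -(mul1r a) -(mul1r b) -(expr1n _ i) -x_bar_2n -exprM mulnC exprM.
have /prednK <- : (0 < 2 * n)%N by rewrite muln_gt0 (ltnW hn).
by rewrite exprSr -!mulrA E.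
Qed.

End QuotientMap.

(** * The annihilator ideal: existence and uniqueness *)

Section Classification.

Variables (N n : nat) (N_gt1 : (1 < N)%N) (hn : (1 < n)%N).
Variables (gT : finGroupType) (M : cayley_map gT) (w : gT).
Hypotheses (cG : abelian [set: gT]) (eG : (exponent [set: gT] %| N)%N).
Hypothesis Aw : w \in cm_gens M.
Hypothesis rhoXn : {in cm_gens M, forall v, v^-1%g = (cm_rho M ^+ n)%g v}.
Hypothesis rhoXu : forall u, (0 < u < n)%N -> (cm_rho M ^+ u)%g w != w^-1%g.
Variable f : gT -> gT.
Hypothesis fM : {morph f : x y / (x * y)%g}.
Hypothesis f_rho : {in cm_gens M, f =1 cm_rho M}.

Local Notation V := (exp_mod N_gt1 cG eG).
Local Notation act := (poly_act (exp_mod_lin N_gt1 cG eG fM) (w : V)).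

Lemma iter_rhoX k : iter k f w = (cm_rho M ^+ k)%g w.
Proof.
elim: k => [|k IHk]; first by rewrite perm1.
by rewrite expgSr permM /= IHk f_rho ?rhoX_gens.
Qed.

Lemma rho_act_Xn k : act 'X^k = (cm_rho M ^+ k)%g w.
Proof. by rewrite poly_actXn -iter_rhoX. Qed.

(** Through this, [rhoXn] and [rhoXu] become the two conditions defining [ideal_I N n]. *)
Lemma act_Xn_add1 k : (act ('X^k + 1) == 0) = ((cm_rho M ^+ k)%g w == w^-1%g).
Proof.
by rewrite raddfD /= poly_act1 rho_act_Xn addr_eq0.
Qed.

Lemma exp_mod_gen_neq0 : (w : V) != 0.
Proof.
by apply: contraNneq (cm_gens_neq1 M) => w1; have <- : w = 1%g := w1.
Qed.

Definition act_ideal : ideal_I N n.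
Proof.
exists (ann_ideal (exp_mod_lin N_gt1 cG eG fM) exp_mod_gen_neq0) => [|u lt_un].
  by rewrite mem_ann_ideal act_Xn_add1 rhoXn.
by rewrite mem_ann_ideal act_Xn_add1 rhoXu.
Defined.

Lemma mem_act_ideal p : (p \in ideal_val act_ideal) = (act p == 0).
Proof. by []. Qed.

Lemma act_surj g : exists p, act p == (g : V).
Proof.
move: g; apply: (generated_ind (cm_gens_generate M)) => [|g a Aa [p /eqP <-]].
  by exists 0; rewrite raddf0.
have [k ->] := gens_rhoX Aw Aa; exists (p + 'X^k).
by rewrite raddfD /= rho_act_Xn.
Qed.

(** Two preimages of [g] under [act] differ by an annihilating polynomial, so the class does not
    depend on the choice made by [xchoose]. *)
Definition act_inv (g : gT) : F_quot hn act_ideal :=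
  F_pi hn act_ideal (xchoose (act_surj g)).

Lemma act_invK p : act_inv (act p) = F_pi hn act_ideal p.
Proof.
apply/eqP; rewrite F_pi_eq mem_act_ideal raddfB subr_eq0.
exact: xchooseP (act_surj (act p)).
Qed.

(** [act_inv] is additive and sends the k-th rotate of [w] to [x_bar ^+ k], so it matches generators
    and rotations. *)
Lemma act_isom : cm_isomorphic M (M_Q hn act_ideal).
Proof.
have actP (P : gT -> Prop) : (forall p, P (act p)) -> forall g, P g.
  by move=> Pact g; have [p /eqP <-] := act_surj g.
have invM : {morph act_inv : a b / (a * b)%g}.
  move=> a b; move: a; apply: (actP) => p; move: b; apply: (actP) => q.
  have -> : (act p * act q)%g = act (p + q) by rewrite raddfD.
  by rewrite !act_invK raddfD.
have inv_inj : injective act_inv.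
  move=> a b; move: a; apply: (actP) => p; move: b; apply: (actP) => q.
  rewrite !act_invK => /eqP; rewrite F_pi_eq mem_act_ideal raddfB subr_eq0.
  by move/eqP.
have inv_rhoX k : act_inv ((cm_rho M ^+ k)%g w) = x_bar hn act_ideal ^+ k.
  by rewrite -rho_act_Xn act_invK rmorphXn.
exists act_inv; apply: morphism_isom => // [|v|v Av].
- exists (fun a : F_quot hn act_ideal => act (generic_quotient.repr
    (a : {ideal_quot (ideal_val act_ideal)}))).
    apply: (actP) => p; rewrite act_invK; apply/eqP.
    rewrite -subr_eq0 -raddfB -mem_act_ideal -(F_pi_eq hn).
    by rewrite /F_pi reprK.
  by move=> a; rewrite act_invK /F_pi reprK.
- rewrite mem_gens_M_Q; apply/OmegaP/idP => [[k]|Av].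
    by rewrite -inv_rhoX => /inv_inj->; rewrite rhoX_gens.
  by have [k ->] := gens_rhoX Aw Av; exists k.
have [k ->] := gens_rhoX Aw Av.
rewrite -permM -expgSr !inv_rhoX rho_M_Q ?exprS //.
by apply/OmegaP; exists k.
Qed.

Lemma act_ideal_unique (Q : ideal_I N n) :
  cm_isomorphic M (M_Q hn Q) -> Q =i act_ideal.
Proof.
case=> phi isophi; have [/bij_inj phi_inj _ _] := isophi.
have invMQ :
    {in cm_gens (M_Q hn Q), forall z, z^-1%g = (cm_rho (M_Q hn Q) ^+ n)%g z}.
  by move=> z; rewrite mem_gens_M_Q => Oz; rewrite rhoX_M_Q // x_bar_n mulN1r.
pose psi g : F_quot hn Q := ((phi 1%g)^-1 * phi g)%g.
have psiD a b : psi (a * b)%g = psi a + psi b.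
  exact: (isom_translate_morph isophi rhoXn invMQ).
have psi1 : psi 1%g = 0 by rewrite /psi mulVg.
have psi_gens v : v \in cm_gens M -> psi v \in Omega_seq hn Q.
  by move/(isom_arc_gens isophi 1%g); rewrite mul1g mem_gens_M_Q.
have psi_rho v : v \in cm_gens M -> psi (cm_rho M v) = x_bar hn Q * psi v.
  move=> Av; rewrite -rho_M_Q ?psi_gens //.
  by have := isom_arc_rhoX isophi 1%g 1 Av; rewrite !mul1g.
have psi_inj : injective psi by move=> a b /mulgI/phi_inj.
clearbody psi.
(* [f] is the rotation on generators only; additivity of both sides carries the identity to the
   whole group. *)
have psi_f g : psi (f g) = x_bar hn Q * psi g.
  move: g; apply: (generated_ind (cm_gens_generate M)) => [|g a Aa IHg].
    have f1 : f 1%g = 1%g by apply: (mulgI (f 1%g)); rewrite -fM !mulg1.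
    by rewrite f1 psi1 mulr0.
  by rewrite fM !psiD IHg mulrDr f_rho // psi_rho.
have psi_act p : psi (act p) = F_pi hn Q p * psi w.
  elim/poly_ind: p => [|p c IHp]; first by rewrite !raddf0 mul0r.
  rewrite raddfD /= [LHS]psiD poly_actMX psi_f IHp rmorphD rmorphM mulrDl /=.
  rewrite mulrCA mulrA; congr (_ + _); rewrite F_piC.
  rewrite -[c%:P]mulr1 mul_polyC linearZ /= poly_act1.
  change (psi (w ^+ c)%g = psi w *+ c).
  by elim: (c : nat) => [|k IHk]; rewrite ?expg0 // expgS psiD IHk mulrS.
(* Membership of [p] in [Q] means that its class is 0; multiplying by the cancellable [psi w] turns
   this into [psi (act p) = 0], and [psi] is injective. *)
move=> p; rewrite mem_act_ideal.
rewrite -[p in LHS]subr0 -(F_pi_eq hn) raddf0.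
rewrite -(inj_eq (Omega_lreg (psi_gens w Aw))) mulr0 mulrC -psi_act -psi1.
by rewrite (inj_eq psi_inj).
Qed.

End Classification.

(** Common core of both cases: [n] is the least positive power of the rotation that inverts [w]. *)
Lemma regular_balanced_M_Q (N n : nat) (hN : (1 < N)%N) (hn : (1 < n)%N)
    (gT : finGroupType) (M : cayley_map gT) (w : gT) :
    abelian [set: gT] -> exponent [set: gT] = N -> regular_balanced 1 M ->
    w \in cm_gens M -> w^-1%g = (cm_rho M ^+ n)%g w ->
    (forall u, (0 < u < n)%N -> u != n %[mod valency M]) ->
  exists Q : ideal_I N n, cm_isomorphic M (M_Q hn Q) /\
    forall Q' : ideal_I N n, cm_isomorphic M (M_Q hn Q') -> Q' =i Q.
Proof.
move=> cG eG rbM Aw wV rhoXu.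
have eGN : (exponent [set: gT] %| N)%N by rewrite eG.
have [f fM f_rho] := regular_balanced_morphism rbM Aw wV.
have rhoXn := balanced_invg_rhoX rbM.2 Aw wV.
have rhoXu' u : (0 < u < n)%N -> (cm_rho M ^+ u)%g w != w^-1%g.
  by move=> lt_un; rewrite wV eq_rhoX // rhoXu.
exists (act_ideal hN cG eGN Aw rhoXn rhoXu' fM f_rho).
by split=> [|Q]; [apply: act_isom | apply: act_ideal_unique].
Qed.

Theorem theorem2p1 (N n : nat) (hN : (2 <= N)%N) (hn : (1 < n)%N) :
  ((2 < N)%N ->
   forall (gT : finGroupType) (M : cayley_map gT),
     abelian [set: gT] -> exponent [set: gT] = N ->
     valency M = (2 * n)%N -> regular_balanced 1 M -> type_I 1 M ->
     exists Q : ideal_I N n,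
       cm_isomorphic M (M_Q hn Q) /\
       forall Q' : ideal_I N n, cm_isomorphic M (M_Q hn Q') -> Q' =i Q)
  /\
  (N = 2%N ->
   forall (gT : finGroupType) (M : cayley_map gT),
     abelian [set: gT] -> exponent [set: gT] = 2%N ->
     valency M = n -> regular_balanced 1 M -> type_II 1 M ->
     exists Q : ideal_I N n,
       cm_isomorphic M (M_Q hn Q) /\
       forall Q' : ideal_I N n, cm_isomorphic M (M_Q hn Q') -> Q' =i Q).
Proof.
have n_gt0 := ltnW hn; split=> [_ | N2] gT M cG eG vM rbM [w [l]].
  rewrite subnn gcd0n vM => -[Aw wV l_n2].
  (* Inverting twice gives [2 * n %| 2 * l], so [n %| l]. *)
  have /eqP l2 : (cm_rho M ^+ (l + l))%g w == (cm_rho M ^+ 0)%g w.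
    rewrite perm1 expgD permM -wV -(balanced_invg_rhoX rbM.2 Aw wV) ?invgK //.
    exact: cm_gensV.
  have dv_nl : (n %| l)%N.
    move/eqP: l2; rewrite eq_rhoX // vM mod0n -/(dvdn _ _).
    by rewrite addnn -mul2n dvdn_pmul2l.
  apply: (@regular_balanced_M_Q N n hN hn gT M w) => // [|u /andP[u0 lt_un]].
    rewrite wV; apply/eqP; rewrite eq_rhoX // vM.
    (* Type I makes [l] an odd multiple of [n], hence congruent to [n] modulo [2 * n]. *)
    case/dvdnP: dv_nl l_n2 => q ->; rewrite dvdn_pmul2r // dvdn2 negbK => qo.
    rewrite -muln_modl modn2 qo mul1n modn_small //.
    by rewrite mul2n -addnn -ltn_subLR ?subnn.
  have lt_n : (n < 2 * n)%N by rewrite mul2n -addnn -ltn_subLR ?subnn.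
  by rewrite vM !modn_small ?(ltn_trans lt_un) // ltn_eqF.
rewrite subnn gcd0n vM => -[Aw wV dv_nl].
have eN : exponent [set: gT] = N by rewrite eG N2.
apply: (@regular_balanced_M_Q N n hN hn gT M w) => // [|u /andP[u0 lt_un]].
  (* Here the valency is [n], so [l] and [n] are both 0 modulo it. *)
  rewrite wV; apply/eqP; rewrite eq_rhoX // vM modnn.
  by rewrite -/(dvdn _ _).
by rewrite vM modnn modn_small // -lt0n.
Qed.
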